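(* Let $n,m\in\mathbb{N}$, let $A\in\{0,1\}^{n\times m}$, let $X\subseteq\{0,1\}^m$ with $\mathbf{0}_m\in X$, and let $f:\{0,1\}^m\to\mathbb{R}$ with $f(\mathbf{0}_m)=0$. For $w\in\{0,1\}^n$ consider the combinatorial packing game $$\nu_{X,f}(w)=\max_{x\in X}\,[f(x):\ Ax\le w].$$ Assume: (a) $f$ is $Q$-individually subadditive, i.e. $f(x)=f(QQ^{\dagger}x)\le(f(q_1),\dots,f(q_k))\,Q^{\dagger}x$ for all $x\in X$, where $Q$ is as in (b); and $F:\mathrm{cone}(X)\to\mathbb{R}$, $F(x)=(f(q_1),\dots,f(q_k))\,Q^{\dagger}x$, is the $Q$-basis-linear relaxation of $f$; (b) there is a set of linearly independent generators $Q=\{q_1,\dots,q_k\}\subseteq X$ ($k\le m$) such that $\mathrm{cone}(X)=\mathrm{cone}(Q)$; (c) $Aq_j\in\{0,1\}^n\setminus\{\mathbf{0}_n\}$ for all $j\in[k]$. For $w\in\{0,1\}^n$ define the relaxed game $$\nu_{\mathrm{cone}(X),F}(w)=\max_{x\in\mathrm{cone}(X)}[F(x):\ Ax\le w].$$ Then: (i) The core of $\nu_{X,f}$ is non-empty if and only if $\nu_{X,f}(\mathbf{1}_n)=\nu_{\mathrm{cone}(X),F}(\mathbf{1}_n)$. (ii) The core of $\nu_{X,f}$, whenever non-empty, coincides with the set of optimal solutions of the dual of the relaxed problem at $w=\mathbf{1}_n$; namely $$\mathrm{core}(\nu_{X,f})=\operatorname*{arg\,min}_{y\in\mathbb{R}^n_+}\left[\mathbf{1}_n^Ty:\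 y^TAQ\ge(f(q_1),\dots,f(q_k))\right].$$
   Context: Notation: $[k]=\{1,\dots,k\}$; $\mathbf{0}_n,\mathbf{1}_n$ are the all-zero and all-one vectors in $\mathbb{R}^n$ (similarly $\mathbf{0}_m$ in $\mathbb{R}^m$); $\mathbb{R}^n_+$ is the set of componentwise non-negative vectors; vector inequalities are componentwise; $\mathrm{cone}(S)$ is the convex conic hull of $S$. The symbol $Q$ also denotes the $m\times k$ matrix with columns $q_1,\dots,q_k$, and $Q^{\dagger}=(Q^TQ)^{-1}Q^T\in\mathbb{R}^{k\times m}$ is its left Moore–Penrose inverse, so every $x\in\mathrm{cone}(X)=\mathrm{cone}(Q)$ satisfies $x=QQ^{\dagger}x$ with $Q^{\dagger}x\ge 0$. The core of a (revenue) game $\nu:\{0,1\}^n\to\mathbb{R}$ is $\mathrm{core}(\nu)=\{y\in\mathbb{R}^n:\ \mathbf{1}_n^Ty=\nu(\mathbf{1}_n),\ a^Ty\ge\nu(a)\ \text{for all } a\in\{0,1\}^n\}$. *)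

(* Defs.v *)
From HB Require Import structures.
From mathcomp Require Import all_boot all_order all_algebra.
From mathcomp Require Import boolp classical_sets reals.

Set Implicit Arguments.
Unset Strict Implicit.
Unset Printing Implicit Defensive.

Import Order.TTheory GRing.Theory Num.Theory.
Local Open Scope classical_set_scope.
Local Open Scope ring_scope.

(* Binary vectors are the real vectors with entries in {0, 1}. A function on
   {0,1}^m, or on a cone, is a total function on 'cV[R]_m of which only the
   values on that domain are ever used. *)
Definition binary (R : realType) (p q : nat) : set 'M[R]_(p, q) :=
  [set M | forall i j, M i j = 0 \/ M i j = 1].

Definition ones (R : realType) (n : nat) : 'cV[R]_n := const_mx 1.

Definition lemx (R : realType) (p q : nat) (M N : 'M[R]_(p, q)) : Prop :=
  forall i j, M i j <= N i j.

Definition dot (R : realType) (n : nat) (u v : 'cV[R]_n) : R :=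
  (u^T *m v) 0 0.

(* The empty combination is allowed, so cone set0 = [set 0]. *)
Definition cone (R : realType) (m : nat) (S : set 'cV[R]_m) : set 'cV[R]_m :=
  [set x | exists (N : nat) (s : 'I_N -> 'cV[R]_m) (l : 'I_N -> R),
     [/\ forall i, S (s i), forall i, 0 <= l i & x = \sum_i l i *: s i]].

Definition columns (R : realType) (m k : nat) (Q : 'M[R]_(m, k)) :
  set 'cV[R]_m := range (fun j : 'I_k => col j Q).

(* The left inverse of Q when the columns of Q are linearly independent. *)
Definition pinv (R : realType) (m k : nat) (Q : 'M[R]_(m, k)) : 'M[R]_(k, m) :=
  invmx (Q^T *m Q) *m Q^T.

Definition is_max (R : realType) (S : set R) (v : R) : Prop :=
  S v /\ ubound S v.

(* The maximum of S; the default value 0 only occurs if S has no maximum. *)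
Definition max_of (R : realType) (S : set R) : R := xget 0 (is_max S).

Lemma max_ofE (R : realType) (S : set R) (v : R) : is_max S v -> max_of S = v.
Proof.
move=> Sv; apply: xget_unique => // u [Su ubu]; case: Sv => Sv ubv.
by apply/eqP; rewrite eq_le ubv ?ubu.
Qed.

Definition argmin (R : realType) (T : Type) (D : set T) (g : T -> R) : set T :=
  [set y | D y /\ forall z, D z -> g y <= g z].

Definition packing_game (R : realType) (n m : nat) (A : 'M[R]_(n, m))
    (X : set 'cV[R]_m) (f : 'cV[R]_m -> R) (w : 'cV[R]_n) : R :=
  max_of [set f x | x in [set x | X x /\ lemx (A *m x) w]].

Definition core (R : realType) (n : nat) (nu : 'cV[R]_n -> R) :
    set 'cV[R]_n :=
  [set y | dot (ones R n) y = nu (ones R n) /\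
           forall a, binary a -> nu a <= dot a y].

Definition column_values (R : realType) (m k : nat) (Q : 'M[R]_(m, k))
    (f : 'cV[R]_m -> R) : 'rV[R]_k :=
  \row_j f (col j Q).

Definition basis_linear_relaxation (R : realType) (m k : nat)
    (Q : 'M[R]_(m, k)) (f : 'cV[R]_m -> R) (x : 'cV[R]_m) : R :=
  (column_values Q f *m (pinv Q *m x)) 0 0.

Definition individually_subadditive (R : realType) (m k : nat)
    (Q : 'M[R]_(m, k)) (X : set 'cV[R]_m) (f : 'cV[R]_m -> R) : Prop :=
  forall x, X x ->
    f x = f (Q *m (pinv Q *m x)) /\
    f (Q *m (pinv Q *m x)) <= (column_values Q f *m (pinv Q *m x)) 0 0.

Definition dual_feasible (R : realType) (n m k : nat) (A : 'M[R]_(n, m))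
    (Q : 'M[R]_(m, k)) (f : 'cV[R]_m -> R) : set 'cV[R]_n :=
  [set y | lemx 0 y /\ lemx (column_values Q f) (y^T *m A *m Q)].

(* Main.v *)
Require Import Defs.
From mathcomp Require Import all_boot all_order all_algebra.
From mathcomp Require Import boolp classical_sets reals.

Import Order.TTheory GRing.Theory Num.Theory.
Local Open Scope classical_set_scope.
Local Open Scope ring_scope.

(** Every [x] in [cone X] is [Q *m t] for a unique [t >= 0], namely
    [t = pinv Q *m x], so the relaxed problem at [w] is the linear program
    maximising [c *m t] over [t >= 0] with [A *m Q *m t <= w], where
    [c = column_values Q f].  Its dual at [w = 1] is the minimisation in the
    statement.  Three facts give the theorem.

    Core vectors are dual feasible ([core_dual_feasible]): test a core
    allocation on the unit vectors, where the game is at least [f 0 = 0], and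
    on the binary vectors [A *m col j Q], where it is at least [f (col j Q)].

    Weak duality ([relaxation_le_dual]) bounds the relaxation, and hence by
    subadditivity also the game ([game_le_dual]), at every [w] by [dot w z] for
    each dual feasible [z].  Thus a dual feasible [z] lies in the core as soon
    as its total is the value of the game at [1]; conversely the total of a
    core allocation is both the value of the game and a dual value, so it is
    the least dual value.  This already gives the second assertion.

    Strong duality ([relaxed_game_dual]) provides a dual feasible [z] whose
    total is the maximum of the relaxation.  If the game and the relaxation
    have the same value at [1], this [z] is in the core; if the core contains
    some [y], the total of [y] is at least the relaxed value and at most the
    total of [z], so the two values agree.  The existence of [z] is an instance of
    linear programming duality ([lp_strong_duality]), which is deduced from
    Farkas' lemma ([farkas]), applied once to the primal and once to the dual
    program.  The primal program is feasible at [t = 0], and its dual is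
    feasible because every column of [A *m Q] is binary and nonzero. *)

(** * Entrywise order on matrices *)

Section EntrywiseOrder.

Set Implicit Arguments.
Unset Strict Implicit.

Variable R : realType.

Lemma lemx_mul2l (p q r : nat) (M : 'M[R]_(p, q)) (N P : 'M[R]_(q, r)) :
  lemx 0 M -> lemx N P -> lemx (M *m N) (M *m P).
Proof.
move=> M0 NP i j; rewrite !mxE; apply: ler_sum => l _.
by apply: ler_wpM2l => //; have := M0 i l; rewrite mxE.
Qed.

Lemma lemx_mul2r (p q r : nat) (M : 'M[R]_(q, r)) (N P : 'M[R]_(p, q)) :
  lemx 0 M -> lemx N P -> lemx (N *m M) (P *m M).
Proof.
move=> M0 NP i j; rewrite !mxE; apply: ler_sum => l _.
by apply: ler_wpM2r => //; have := M0 l j; rewrite mxE.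
Qed.

Lemma lemx_tr (p q : nat) (M N : 'M[R]_(p, q)) : lemx M N -> lemx M^T N^T.
Proof. by move=> MN i j; rewrite !mxE. Qed.

Lemma lemx0_tr (p q : nat) (M : 'M[R]_(p, q)) : lemx 0 M -> lemx 0 M^T.
Proof. by move=> M0; rewrite -trmx0; apply: lemx_tr. Qed.

Lemma lemx_opp (p q : nat) (M N : 'M[R]_(p, q)) : lemx M N -> lemx (- N) (- M).
Proof. by move=> MN i j; rewrite !mxE lerN2. Qed.

Lemma binary_ge0 (p q : nat) (M : 'M[R]_(p, q)) : binary M -> lemx 0 M.
Proof. by move=> Mb i j; rewrite mxE; case: (Mb i j) => ->. Qed.

Lemma dotE (n : nat) (u v : 'cV[R]_n) : dot u v = (v^T *m u) 0 0.
Proof. by rewrite /dot -[u in RHS]trmxK -trmx_mul [RHS]mxE. Qed.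

End EntrywiseOrder.

(** * Farkas' lemma and linear programming duality *)

Section LinearProgramming.

Set Implicit Arguments.
Unset Strict Implicit.

Variable R : realType.

(** Bartl's argument, by induction on the number of rows: if a point [x]
    separating [c] from the cone of the other rows violates the first row [a],
    then subtracting suitable multiples of [a] makes every form vanish at [x],
    and the induction hypothesis applies to the resulting forms. *)
Lemma farkas (p q : nat) (M : 'M[R]_(p, q)) (c : 'rV[R]_q) :
  (exists2 y : 'rV[R]_p, lemx 0 y & y *m M = c) \/
  (exists2 x : 'cV[R]_q, lemx (M *m x) 0 & 0 < (c *m x) 0 0).
Proof.
elim: p M c => [|p IHp] M c.
  have [->|c_neq0] := eqVneq c 0.
    by left; exists 0; [move=> i j | rewrite mul0mx].
  right; exists c^T; first by case.
  rewrite mxE lt_neqAle; under eq_bigr do rewrite mxE -expr2.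
  rewrite sumr_ge0 ?andbT => [|i _]; last exact: sqr_ge0.
  rewrite eq_sym psumr_neq0 => [|i _]; last exact: sqr_ge0.
  have /rV0Pn[j cj] := c_neq0.
  by apply/hasP; exists j; rewrite ?mem_index_enum //= lt_neqAle sqr_ge0
    eq_sym sqrf_eq0 cj.
suff step (a : 'rV[R]_q) (N : 'M[R]_(p, q)) :
    (exists2 y : 'rV[R]_(1 + p), lemx 0 y & y *m col_mx a N = c) \/
    (exists2 x : 'cV[R]_q, lemx (col_mx a N *m x) 0 & 0 < (c *m x) 0 0).
  by have := step (@usubmx _ 1 p q M) (@dsubmx _ 1 p q M); rewrite vsubmxK.
have [[y y0 yN]|[x Nx cx]] := IHp N c.
  left; exists (row_mx (0 : 'rV_1) y); last by rewrite mul_row_col mul0mx add0r.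
  by move=> i j; rewrite !mxE; case: splitP => l _; rewrite ?mxE //;
    have := y0 i l; rewrite mxE.
have [ax|ax] := lerP ((a *m x) 0 0) 0.
  right; exists x => // i j; rewrite mul_col_mx !mxE.
  case: splitP => l _; first by rewrite !ord1.
  by have := Nx l j; rewrite !mxE.
pose x1 := ((a *m x) 0 0)^-1 *: x.
have ax1 : a *m x1 = 1%:M.
  apply/matrixP => i j.
  by rewrite !ord1 -scalemxAr mxE mulVf ?gt_eqF // mxE.
have Nx1 : lemx (N *m x1) 0.
  move=> i j; rewrite -scalemxAr mxE [leRHS]mxE pmulr_rle0 ?invr_gt0 //.
  by have := Nx i j; rewrite [leRHS]mxE.
have cx1 : 0 < (c *m x1) 0 0 by rewrite -scalemxAr mxE mulr_gt0 ?invr_gt0.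
have [[y y0 yN]|[z Nz cz]] := IHp (N - N *m x1 *m a) (c - c *m x1 *m a).
  left; exists (row_mx (c *m x1 - y *m N *m x1) y).
    move=> i j; rewrite !mxE; case: splitP => l _; last first.
      by have := y0 i l; rewrite mxE.
    have := lemx_mul2l y0 Nx1 0 0; rewrite mulmx0 mulmxA !ord1 => yNx.
    by rewrite mxE [X in _ + X]mxE subr_ge0 (le_trans yNx) // mxE ltW.
  rewrite mul_row_col mulmxBl.
  move: yN; rewrite mulmxBr !mulmxA => /eqP.
  rewrite subr_eq => /eqP yN.
  by rewrite [X in _ + X]yN addrC addrACA subrK subrr addr0.
(* [z - x1 *m a *m z] is the projection of [z] along [x1] to the kernel of
   [a]. *)
right; exists (z - x1 *m (a *m z)); last first.
  by move: cz; rewrite mulmxBl mulmxBr !mulmxA.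
move=> i j; rewrite mul_col_mx !mxE; case: splitP => l _.
  by rewrite mulmxBr mulmxA ax1 mul1mx subrr mxE.
by have := Nz l j; rewrite mulmxBl mulmxBr !mulmxA [leRHS]mxE.
Qed.

(** A bound [v] on the value of a feasible program is matched by a dual
    feasible point: this is [farkas] for the system [z *m B - u = c],
    [z *m b + s = v] in the nonnegative unknowns [z], [u] and [s]. *)
Lemma lp_dual_bound (n k : nat) (B : 'M[R]_(n, k)) (b : 'cV[R]_n)
    (c : 'rV[R]_k) (v : R) (t0 : 'cV[R]_k) :
  lemx 0 t0 -> lemx (B *m t0) b ->
  (forall t, lemx 0 t -> lemx (B *m t) b -> (c *m t) 0 0 <= v) ->
  exists z : 'rV[R]_n, [/\ lemx 0 z, lemx c (z *m B) & (z *m b) 0 0 <= v].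
Proof.
move=> t0_ge0 Bt0 bound.
have [[y]|[x]] := farkas
  (col_mx (row_mx B b) (col_mx (row_mx (- 1%:M) 0) (row_mx 0 1%:M)))
  (row_mx c v%:M).
  rewrite -[y]hsubmxK -[rsubmx y]hsubmxK.
  move: (lsubmx y) (lsubmx (rsubmx y)) (rsubmx (rsubmx y)) => z u s y0.
  rewrite !mul_row_col !mul_mx_row !add_row_mx => /eq_row_mx[].
  rewrite !mulmx0 !mulmx1 add0r addr0 mulmxN mulmx1 => zB zb.
  exists z; split=> [i j | i j |].
  - by have := y0 i (lshift _ j); rewrite row_mxEl !mxE.
  - have := y0 i (rshift _ (lshift _ j)).
    rewrite row_mxEr row_mxEl mxE -zB [X in _ -> X <= _]mxE => u0.
    by rewrite [X in _ + X]mxE gerBl.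
  - have := y0 0 (rshift _ (rshift _ 0)).
    rewrite !row_mxEr mxE => s0.
    have -> : v = (v%:M : 'M[R]_1) 0 0 by rewrite mxE.
    by rewrite -zb [leRHS]mxE lerDl.
rewrite -[x]vsubmxK.
move: (usubmx x) (dsubmx x) => t s.
rewrite !mul_col_mx !mul_row_col !mul0mx mulNmx !mul1mx add0r addr0.
rewrite [s]mx11_scalar !mul_mx_scalar; move: (s 0 0) => {}s xle.
have Bt i j : (B *m t) i j <= - s * b i j.
  have := xle (lshift _ i) j; rewrite col_mxEu [X in X <= _]mxE.
  by rewrite [X in _ + X]mxE [leRHS]mxE mulNr -lerBrDr sub0r.
have t_ge0 : lemx 0 t.
  move=> i j; have := xle (rshift _ (lshift _ i)) j.
  by rewrite col_mxEd col_mxEu !mxE oppr_le0.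
have : s <= 0.
  by have := xle (rshift _ (rshift _ 0)) 0; rewrite !col_mxEd !mxE eqxx mulr1n.
rewrite mxE [X in _ + X]mxE [X in _ * X]mxE eqxx mulr1n.
rewrite le_eqVlt => /orP[/eqP s0|s_lt0].
  (* [t] is a direction of recession along which the objective increases *)
  rewrite s0 mul0r addr0 => ct.
  have ct0 := bound t0 t0_ge0 Bt0.
  pose l := (v - (c *m t0) 0 0 + 1) / (c *m t) 0 0.
  have l_ge0 : 0 <= l.
    by apply: divr_ge0 (ltW ct); rewrite addr_ge0 ?ler01 ?subr_ge0.
  have /bound : lemx 0 (t0 + l *: t).
    move=> i j; rewrite !mxE addr_ge0 ?(mulr_ge0 l_ge0) //.
      by have := t0_ge0 i j; rewrite mxE.
    by have := t_ge0 i j; rewrite mxE.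
  rewrite !mulmxDr -!scalemxAr => {}bound.
  have : lemx (B *m t0 + l *: (B *m t)) b.
    move=> i j; rewrite mxE -[leRHS]addr0 lerD // mxE mulr_ge0_le0 //.
    by rewrite (le_trans (Bt i j)) // s0 oppr0 mul0r.
  move=> /bound; rewrite mxE [X in _ + X]mxE divfK ?gt_eqF //.
  by rewrite addrA subrKC gerDl ler10.
have Ns : 0 < - s by rewrite oppr_gt0.
have /bound : lemx 0 ((- s)^-1 *: t).
  move=> i j; rewrite [leLHS]mxE mxE mulr_ge0 ?invr_ge0 ?(ltW Ns) //.
  by have := t_ge0 i j; rewrite mxE.
rewrite -!scalemxAr => {}bound.
have /bound : lemx ((- s)^-1 *: (B *m t)) b.
  by move=> i j; rewrite mxE mulrC ler_pdivrMr // mulrC.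
rewrite mxE mulrC ler_pdivrMr // mulrN => ct.
by rewrite -[s * v]opprK subr_gt0 mulrC ltNge ct.
Qed.

(** If both programs are feasible, then they have solutions without duality
    gap.  The dual solution comes from [lp_dual_bound] with the supremum of
    the primal values as bound; the primal solution comes from the same lemma
    for the dual program, rewritten as a maximisation. *)
Lemma lp_strong_duality (n k : nat) (B : 'M[R]_(n, k)) (b : 'cV[R]_n)
    (c : 'rV[R]_k) (t0 : 'cV[R]_k) (z0 : 'rV[R]_n) :
  lemx 0 t0 -> lemx (B *m t0) b -> lemx 0 z0 -> lemx c (z0 *m B) ->
  exists (t : 'cV[R]_k) (z : 'rV[R]_n),
    [/\ lemx 0 t, lemx (B *m t) b, lemx 0 z, lemx c (z *m B)
      & (z *m b) 0 0 <= (c *m t) 0 0].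
Proof.
move=> t0_ge0 Bt0 z0_ge0 z0B.
pose V := [set (c *m t) 0 0 | t in [set t | lemx 0 t /\ lemx (B *m t) b]].
have weak z : lemx 0 z -> lemx c (z *m B) -> ubound V ((z *m b) 0 0).
  move=> z_ge0 zB _ [t [t_ge0 Bt] <-].
  apply: le_trans (lemx_mul2r t_ge0 zB 0 0) _.
  by rewrite -mulmxA; apply: lemx_mul2l.
have V_neq0 : V !=set0 by exists ((c *m t0) 0 0), t0.
have V_sup : has_sup V by split=> //; exists ((z0 *m b) 0 0); apply: weak.
have [|z [z_ge0 zB zb]] := lp_dual_bound (v := sup V) (c := c) t0_ge0 Bt0.
  by move=> t t_ge0 Bt; apply: (sup_upper_bound V_sup); exists t.
have [||t [t_ge0 Bt ct]] := lp_dual_bound (v := - sup V) (B := - B^T)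
    (b := - c^T) (c := - b^T) (lemx0_tr z_ge0); first 1 last.
- move=> y y_ge0; rewrite mulNmx => By.
  rewrite mulNmx mxE lerN2; apply: sup_le_ub => //.
  have -> : (b^T *m y) 0 0 = (y^T *m b) 0 0.
    by rewrite -[y in LHS]trmxK -trmx_mul [LHS]mxE.
  apply: weak; first exact: lemx0_tr.
  by have := lemx_tr (lemx_opp By); rewrite !opprK trmxK trmx_mul trmxK.
- exists t^T, z; split=> //.
  + exact: lemx0_tr.
  + have := lemx_tr (lemx_opp Bt).
    by rewrite mulmxN !opprK trmxK trmx_mul trmxK.
  + move: ct; rewrite mulmxN mxE lerN2 => ct.
    apply: le_trans zb (le_trans ct _).
    by rewrite -[t in X in X <= _]trmxK -trmx_mul mxE.
- by rewrite mulNmx -trmx_mul; apply/lemx_opp/lemx_tr.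
Qed.

End LinearProgramming.

(** * Cones and finite maxima *)

Section Cones.

Set Implicit Arguments.
Unset Strict Implicit.

Variables (R : realType) (m : nat).

Lemma subset_cone (S : set 'cV[R]_m) : S `<=` cone S.
Proof.
move=> x Sx; exists 1%N, (fun=> x), (fun=> 1); split=> //.
by rewrite big_ord1 scale1r.
Qed.

Lemma cone_columnsP (k : nat) (Q : 'M[R]_(m, k)) (x : 'cV[R]_m) :
  cone (columns Q) x <-> exists2 t : 'cV[R]_k, lemx 0 t & x = Q *m t.
Proof.
split=> [[N [s [l [sQ l_ge0 ->]]]]|[t t_ge0 ->]].
  have /choice[j sE] : forall i, exists j, s i = col j Q.
    by move=> i; have [j _ <-] := sQ i; exists j.
  exists (\sum_i l i *: delta_mx (j i) 0).
    move=> a b; rewrite mxE summxE; apply: sumr_ge0 => i _.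
    by rewrite !mxE mulr_ge0 ?l_ge0 ?ler0n.
  rewrite mulmx_sumr; apply: eq_bigr => i _.
  by rewrite sE -scalemxAr colE.
exists k, (fun j => col j Q), (fun j => t j 0); split.
- by move=> j; exists j.
- by move=> j; have := t_ge0 j 0; rewrite mxE.
- apply/matrixP => i j; rewrite ord1 summxE mxE.
  by apply: eq_bigr => l _; rewrite !mxE mulrC.
Qed.

Lemma pinv_mul (k : nat) (Q : 'M[R]_(m, k)) :
  row_free Q^T -> pinv Q *m Q = 1%:M.
Proof.
move=> Q_free; rewrite /pinv -mulmxA mulVmx // -row_free_unit.
apply: inj_row_free => u uQQ0; apply: (row_free_inj Q_free).
rewrite mul0mx; apply/rowP => i; rewrite [RHS]mxE; apply/eqP.
(* [u *m (Q^T *m Q) = 0] forces the squared norm of [u *m Q^T] to vanish *)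
have : (u *m Q^T *m (u *m Q^T)^T) 0 0 = 0.
  by rewrite trmx_mul trmxK -mulmxA [Q^T *m _]mulmxA mulmxA uQQ0 mul0mx mxE.
rewrite mxE => /eqP; rewrite psumr_eq0 => [/allP/(_ i)|j _].
  by rewrite mem_index_enum [(_ ^T) _ _]mxE mulf_eq0 orbb => /(_ isT).
by rewrite [(_ ^T) _ _]mxE -expr2 sqr_ge0.
Qed.

(** There are finitely many binary vectors, so a function attains its maximum
    on any nonempty set of them. *)
Lemma binary_max_exists (S : set 'cV[R]_m) (g : 'cV[R]_m -> R) :
  S `<=` @binary R m 1 -> S !=set0 -> exists v, is_max [set g x | x in S] v.
Proof.
move=> S_bin [x0 Sx0].
pose vec (h : {ffun 'I_m -> bool}) : 'cV[R]_m := \col_i (h i)%:R.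
have vecP x : S x -> exists h, vec h = x.
  move=> /S_bin x_bin; exists [ffun i => x i 0 == 1].
  apply/matrixP => i j; rewrite ord1 mxE ffunE.
  by case: (x_bin i 0) => ->; rewrite ?eqxx // eq_sym oner_eq0.
have [h0 h0E] := vecP _ Sx0.
have Sh0 : `[< S (vec h0) >] by apply/asboolP; rewrite h0E.
have [h /asboolP Sh h_max] :=
  @arg_maxP _ _ _ h0 (fun h => `[< S (vec h) >]) (g \o vec) Sh0.
exists (g (vec h)); split; first by exists (vec h).
move=> _ [x Sx <-]; have [l lE] := vecP _ Sx.
by rewrite -lE; apply: h_max; apply/asboolP; rewrite lE.
Qed.

End Cones.

(** * The packing game and its relaxation *)

Section PackingGame.

Set Implicit Arguments.
Unset Strict Implicit.

Variables (R : realType) (n m : nat) (A : 'M[R]_(n, m)).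
Variables (X : set 'cV[R]_m) (f : 'cV[R]_m -> R).
Hypotheses (X_binary : X `<=` @binary R m 1) (X0 : X 0).

Lemma packing_game_max (w : 'cV[R]_n) : lemx 0 w ->
  is_max [set f x | x in [set x | X x /\ lemx (A *m x) w]]
         (packing_game A X f w).
Proof.
move=> w_ge0.
have [||v v_max] := @binary_max_exists R m
    [set x | X x /\ lemx (A *m x) w] f.
- by move=> x [Xx _]; apply: X_binary.
- by exists 0; split=> //; rewrite mulmx0.
- by rewrite /packing_game (max_ofE v_max).
Qed.

Lemma le_packing_game (w : 'cV[R]_n) (x : 'cV[R]_m) :
  lemx 0 w -> X x -> lemx (A *m x) w -> f x <= packing_game A X f w.
Proof. by move=> /packing_game_max[_ ub] Xx Ax; apply: ub; exists x. Qed.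

Variables (k : nat) (Q : 'M[R]_(m, k)).
Hypotheses (f0 : f 0 = 0)
  (f_subadditive : individually_subadditive Q X f)
  (Q_sub_X : columns Q `<=` X)
  (Q_independent : row_free Q^T)
  (cone_X_Q : cone X = cone (columns Q))
  (AQ_binary : forall j : 'I_k, binary (A *m col j Q) /\ A *m col j Q <> 0).

Lemma core_dual_feasible (y : 'cV[R]_n) :
  core (packing_game A X f) y -> dual_feasible A Q f y.
Proof.
move=> [_ y_ge]; split=> [i j | i j].
  have ei_bin : @binary R n 1 (delta_mx i 0).
    by move=> a b; rewrite mxE; case: (_ && _); [right | left].
  rewrite ord1 mxE; apply: le_trans (_ : dot (delta_mx i 0) y <= _); last first.
    by rewrite dotE -colE !mxE.
  apply: le_trans (y_ge _ ei_bin); rewrite -f0.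
  apply: le_packing_game (binary_ge0 ei_bin) X0 _.
  by rewrite mulmx0; apply: binary_ge0.
have [AQj_bin _] := AQ_binary j.
rewrite mxE ord1; apply: le_trans (_ : dot (A *m col j Q) y <= _); last first.
  by rewrite dotE !colE !mulmxA -colE mxE.
apply: le_trans (y_ge _ AQj_bin).
by apply: le_packing_game (binary_ge0 AQj_bin) (Q_sub_X _) _ => //; exists j.
Qed.

Lemma relaxationE (t : 'cV[R]_k) :
  basis_linear_relaxation Q f (Q *m t) = (column_values Q f *m t) 0 0.
Proof.
by rewrite /basis_linear_relaxation [pinv Q *m _]mulmxA pinv_mul // mul1mx.
Qed.

Lemma le_relaxation (x : 'cV[R]_m) :
  X x -> f x <= basis_linear_relaxation Q f x.
Proof. by move=> /f_subadditive[->]. Qed.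

(** Weak duality, for an arbitrary right-hand side [w]. *)
Lemma relaxation_le_dual (w z : 'cV[R]_n) (x : 'cV[R]_m) :
  dual_feasible A Q f z -> cone X x -> lemx (A *m x) w ->
  basis_linear_relaxation Q f x <= dot w z.
Proof.
move=> [z_ge0 zAQ]; rewrite cone_X_Q => /cone_columnsP[t t_ge0 ->] AQt.
rewrite relaxationE dotE; apply: le_trans (lemx_mul2r t_ge0 zAQ 0 0) _.
by rewrite -!mulmxA; apply: lemx_mul2l => //; apply: lemx0_tr.
Qed.

Lemma game_le_dual (w z : 'cV[R]_n) :
  lemx 0 w -> dual_feasible A Q f z -> packing_game A X f w <= dot w z.
Proof.
move=> /packing_game_max[[x [Xx Ax] <-] _] z_feas.
apply: le_trans (le_relaxation Xx) _.
by apply: relaxation_le_dual => //; apply: subset_cone.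
Qed.

Lemma core_of_dual_feasible (z : 'cV[R]_n) :
  dual_feasible A Q f z ->
  dot (ones R n) z = packing_game A X f (ones R n) ->
  core (packing_game A X f) z.
Proof.
by move=> z_feas z1; split=> // a a_bin; apply: game_le_dual => //;
  apply: binary_ge0.
Qed.

Lemma lemx0_ones : lemx 0 (ones R n).
Proof. by move=> i j; rewrite !mxE ler01. Qed.

(** The value [M] at every coordinate, with [M] the sum of the absolute values
    of [f] on the columns of [Q], is dual feasible: every column of [A *m Q]
    has an entry equal to [1]. *)
Lemma dual_feasible_exists : exists z, dual_feasible A Q f z.
Proof.
pose M := \sum_j `|f (col j Q)|.
have M_ge0 : 0 <= M by apply: sumr_ge0.
exists (const_mx M); split=> [i j | i j]; first by rewrite !mxE.
have [AQj_bin AQj_neq0] := AQ_binary j.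
have [l AQlj] : exists l, (A *m col j Q) l 0 = 1.
  apply: contrapT => AQj_neq1; apply: AQj_neq0.
  apply/matrixP => l b; rewrite ord1 [RHS]mxE.
  by case: (AQj_bin l 0) => // AQlj; case: AQj_neq1; exists l.
have -> : ((const_mx M)^T *m A *m Q) i j = \sum_l M * (A *m col j Q) l 0.
  rewrite -mulmxA mxE; apply: eq_bigr => a _.
  by rewrite !mxE; congr (_ * _); apply: eq_bigr => b _; rewrite mxE.
rewrite mxE (bigD1 l) //= AQlj mulr1.
apply: le_trans (_ : M <= _).
  rewrite (le_trans (ler_norm _)) // /M (bigD1 j) //= lerDl.
  by apply: sumr_ge0.
rewrite lerDl; apply: sumr_ge0 => a _; apply: mulr_ge0 => //.
by have := binary_ge0 AQj_bin a 0; rewrite mxE.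
Qed.

(** The relaxed problem at [ones R n] attains its maximum, and the maximum is
    the total of a dual feasible vector. *)
Lemma relaxed_game_dual :
  exists2 z, dual_feasible A Q f z &
    is_max [set basis_linear_relaxation Q f x |
              x in [set x | cone X x /\ lemx (A *m x) (ones R n)]]
           (dot (ones R n) z).
Proof.
have [z0 [z0_ge0 z0AQ]] := dual_feasible_exists.
have [||||t [z [t_ge0 AQt z_ge0 zAQ zt]]] := @lp_strong_duality R n k (A *m Q)
    (ones R n) (column_values Q f) 0 z0^T.
- by [].
- by rewrite mulmx0; apply: lemx0_ones.
- exact: lemx0_tr.
- by rewrite mulmxA.
have z_feas : dual_feasible A Q f z^T.
  by split; [apply: lemx0_tr | rewrite trmxK -mulmxA].
exists z^T => //.
have Qt_cone : cone X (Q *m t).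
  by rewrite cone_X_Q; apply/cone_columnsP; exists t.
rewrite -mulmxA in AQt; split.
  exists (Q *m t) => //; apply/eqP.
  rewrite eq_le (relaxation_le_dual z_feas) //=.
  by rewrite relaxationE dotE trmxK.
by move=> _ [x [Xx Ax] <-]; apply: relaxation_le_dual.
Qed.

Lemma core_le_dual (y z : 'cV[R]_n) :
  core (packing_game A X f) y -> dual_feasible A Q f z ->
  dot (ones R n) y <= dot (ones R n) z.
Proof. by move=> [-> _]; apply/game_le_dual/lemx0_ones. Qed.

Lemma core_nonempty_iff :
  core (packing_game A X f) !=set0 <->
  packing_game A X f (ones R n) =
  packing_game A (cone X) (basis_linear_relaxation Q f) (ones R n).
Proof.
have [z z_feas z_max] := relaxed_game_dual.
have -> : packing_game A (cone X) (basis_linear_relaxation Q f) (ones R n) =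
          dot (ones R n) z by apply: max_ofE.
split=> [[y y_core]|eq_games]; last first.
  by exists z; apply: core_of_dual_feasible.
have [y1 _] := y_core; apply/eqP.
rewrite eq_le (game_le_dual lemx0_ones z_feas) /= -y1.
(* the total of [z] is attained by the relaxation, which the dual feasible
   vector [y] bounds *)
have [[x [Xx Ax] <-] _] := z_max.
by apply: relaxation_le_dual => //; apply: core_dual_feasible.
Qed.

Lemma core_eq_argmin :
  core (packing_game A X f) !=set0 ->
  core (packing_game A X f) =
  argmin (dual_feasible A Q f) (fun y => dot (ones R n) y).
Proof.
move=> [y y_core]; have [y1 _] := y_core.
have y_feas := core_dual_feasible y_core.
apply/seteqP; split=> z.
  move=> z_core; split; first exact: core_dual_feasible.
  by move=> u; apply: core_le_dual.
move=> [z_feas z_min]; apply: core_of_dual_feasible => //.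
apply/eqP; rewrite eq_le -{1}y1 z_min //=.
exact: game_le_dual lemx0_ones z_feas.
Qed.

End PackingGame.

Theorem theorem6 (R : realType) (n m k : nat)
  (A : 'M[R]_(n, m)) (X : set 'cV[R]_m) (f : 'cV[R]_m -> R)
  (Q : 'M[R]_(m, k))
  (A_binary : binary A)
  (X_binary : X `<=` @binary R m 1)
  (X0 : X 0)
  (f0 : f 0 = 0)
  (f_subadditive : individually_subadditive Q X f)
  (Q_sub_X : columns Q `<=` X)
  (k_le_m : (k <= m)%N)
  (Q_independent : row_free Q^T)
  (cone_X_Q : cone X = cone (columns Q))
  (AQ_binary : forall j : 'I_k, binary (A *m col j Q) /\ A *m col j Q <> 0) :
  (core (packing_game A X f) !=set0 <->
   packing_game A X f (ones R n) =
   packing_game A (cone X) (basis_linear_relaxation Q f) (ones R n)) /\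
  (core (packing_game A X f) !=set0 ->
   core (packing_game A X f) =
   argmin (dual_feasible A Q f) (fun y => dot (ones R n) y)).
Proof. by split; [apply: core_nonempty_iff | apply: core_eq_argmin]. Qed.
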